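(* Let $d,n\ge1$, let $\mathbf v^1,\dots,\mathbf v^n\in\mathbb R^d$, let $\mu_{ij}\ge0$ ($i\ne j$) be transition rates, and let $\mathbb B$ be the associated transition matrix, with $I_1(\mathbb B)\neq0$. If $\mathbb B$ is symmetric, i.e. $\mu_{ij}=\mu_{ji}$ for all $i\ne j$, then the drift velocity of the system $$\frac{\partial f_i}{\partial t}+\mathbf v^i\cdot\nabla_{\mathbf x}f_i+\sum_{j\ne i}\bigl(\mu_{ij}f_i-\mu_{ji}f_j\bigr)=0,\qquad i=1,\dots,n,$$ is $$\mathbf v_{\mathrm{drift}}=\frac1n\sum_{i=1}^n\mathbf v^i .$$
   Context: The transition matrix $\mathbb B$ has off-diagonal entries $\mathbb B_{ij}=-\mu_{ji}$ ($i\neq j$) and diagonal entries $\mathbb B_{ii}=\sum_{j\ne i}\mu_{ij}$, so that its columns sum to zero. $\mathbb B(i)$ denotes the submatrix of $\mathbb B$ obtained by deleting the $i$-th row and column (the determinant of the empty matrix is $1$), and $I_1(\mathbb B):=\sum_{i=1}^n\det\mathbb B(i)$. The condition $I_1(\mathbb B)\ne0$ holds when $\mathbb B$ is irreducible. Set $p(\lambda,\mathbf k):=\det(\lambda\mathbb I+\mathrm{diag}(\mathbf v^i\cdot\mathbf k)+\mathbb B)$ and let $\lambda(\mathbf k)$ be the unique smooth branch of solutions of $p(\lambda(\mathbf k),\mathbf k)=0$ near $\mathbf k=\mathbf 0$ with $\lambda(\mathbf 0)=0$. The drift velocity is defined by $$\mathbf v_{\mathrm{drift}}:=-\nabla_{\mathbf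 k}\lambda(\mathbf 0)=\frac1{I_1(\mathbb B)}\sum_{i=1}^n\det\mathbb B(i)\,\mathbf v^i .$$ *)

(* Defs.v *)
From HB Require Import structures.
From mathcomp Require Import all_boot all_order all_algebra.
From mathcomp Require Import all_classical all_reals all_analysis.
Set Implicit Arguments.
Unset Strict Implicit.
Unset Printing Implicit Defensive.
Import Order.TTheory GRing.Theory Num.Theory.
Import numFieldNormedType.Exports.
Local Open Scope classical_set_scope.
Local Open Scope ring_scope.

(* The values mu i i are never used. *)
Definition transition_matrix (R : realType) (n : nat) (mu : 'I_n -> 'I_n -> R) :
    'M[R]_n :=
  \matrix_(i, j) (if i == j then \sum_(l < n | l != i) mu i l else - mu j i).

Definition minor_matrix (R : realType) (n : nat) (i : 'I_n) (B : 'M[R]_n) :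
    'M[R]_n.-1 :=
  row' i (col' i B).

Definition I1 (R : realType) (n : nat) (B : 'M[R]_n) : R :=
  \sum_(i < n) \det (minor_matrix i B).

Definition dotv (R : realType) (d : nat) (u w : 'rV[R]_d) : R :=
  \sum_(a < d) u 0 a * w 0 a.

(* p(lambda, k) = 0 iff the system
     d_t f_i + v^i . grad_x f_i + \sum_(j != i) (mu i j f_i - mu j i f_j) = 0
   has a nonzero solution of the form f_i(t, x) = c_i exp (lambda t + k . x). *)
Definition dispersion (R : realType) (d n : nat) (v : 'I_n -> 'rV[R]_d)
    (mu : 'I_n -> 'I_n -> R) (lam : R) (k : 'rV[R]_d) : R :=
  \det (lam%:M + diag_mx (\row_(i < n) dotv (v i) k) + transition_matrix mu).

Definition partial (R : realType) (d : nat) (a : 'I_d) (f : 'rV[R]_d -> R) :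
    'rV[R]_d -> R :=
  fun k => 'D_(delta_mx 0 a) f k.

Definition gradient (R : realType) (d : nat) (f : 'rV[R]_d -> R)
    (k : 'rV[R]_d) : 'rV[R]_d :=
  \row_(a < d) partial a f k.

(* Intended for U open. *)
Fixpoint Ck (R : realType) (d m : nat) (U : set 'rV[R]_d)
    (f : 'rV[R]_d -> R) : Prop :=
  (forall k, U k -> {for k, continuous f}) /\
  (if m is m'.+1 then
     forall a : 'I_d,
       (forall k, U k -> derivable f k (delta_mx 0 a)) /\ Ck m' U (partial a f)
   else True).

Definition smooth_near (R : realType) (d : nat) (x : 'rV[R]_d)
    (f : 'rV[R]_d -> R) : Prop :=
  exists2 U : set 'rV[R]_d, open_nbhs x U & forall m : nat, Ck m U f.

Definition is_branch (R : realType) (d n : nat) (v : 'I_n -> 'rV[R]_d)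
    (mu : 'I_n -> 'I_n -> R) (lambda : 'rV[R]_d -> R) : Prop :=
  [/\ smooth_near 0 lambda,
      lambda 0 = 0 &
      \forall k \near (0 : 'rV[R]_d), dispersion v mu (lambda k) k = 0].

(* When I1 (transition_matrix mu) != 0 a branch exists and its germ at 0 is
   unique, so the choice made by xget does not affect the gradient at 0. *)
Definition branch (R : realType) (d n : nat) (v : 'I_n -> 'rV[R]_d)
    (mu : 'I_n -> 'I_n -> R) : 'rV[R]_d -> R :=
  xget (fun=> 0) [set lambda | is_branch v mu lambda].

Definition drift_velocity (R : realType) (d n : nat) (v : 'I_n -> 'rV[R]_d)
    (mu : 'I_n -> 'I_n -> R) : 'rV[R]_d :=
  - gradient (branch v mu) 0.

(* Main.v *)
(** Write [A lam k = lam I + diag (v^i . k) + B].  Since the columns of [B] sum to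
    zero, multiplying [A adj(A) = det(A) I] on the left by the row of ones gives
    [p lam k = \sum_i (lam + v^i . k) adj(A lam k)_(i,j)] for every [j].  When [B]
    is symmetric with [I1 B != 0], its kernel is spanned by the vector of ones,
    so [adj B] is a nonzero constant matrix.  Dividing [p (lam (h e_a)) (h e_a) = 0]
    by [h] and letting [h] tend to 0 yields [n d_a lam 0 + \sum_i v^i_a = 0].

    A smooth branch exists because [p] is a polynomial with
    [d_lam p 0 0 = n c != 0]: roots come from the intermediate value theorem, and
    the difference quotient of [p] in [lam], which is again polynomial, gives
    first continuity, then the formula for the partial derivatives, from which
    [C^m] regularity bootstraps. *)
Require Import Defs.
From mathcomp Require Import all_boot all_order all_algebra.
From mathcomp Require Import all_classical all_reals all_analysis.
From mathcomp Require Import ring lra.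
Import Order.TTheory GRing.Theory Num.Theory.
Import numFieldNormedType.Exports.
Local Open Scope ring_scope.
Set Implicit Arguments.
Unset Strict Implicit.
Unset Printing Implicit Defensive.

(** * Kernel and adjugate of a singular matrix with a nonzero principal minor *)

(** Subtracting [x i 0] times the vector of ones gives a kernel vector vanishing at [i]. Its other
    entries solve the homogeneous system of the invertible minor, so they vanish too. *)
Lemma kernel_const (F : fieldType) (n : nat) (B : 'M[F]_n) (i : 'I_n) (x : 'cV[F]_n) :
  B *m const_mx 1 = 0 :> 'cV[F]_n -> \det (row' i (col' i B)) != 0 ->
  B *m x = 0 -> forall j, x j 0 = x i 0.
Proof.
move=> B1 Bi Bx j.
pose y := x - x i 0 *: const_mx 1.
have By : B *m y = 0 by rewrite mulmxBr -scalemxAr B1 Bx scaler0 subr0.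
have yi : y i 0 = 0 by rewrite !mxE mulr1 subrr.
have By' : row' i (col' i B) *m row' i y = 0.
  apply/matrixP => k l; rewrite ord1 !mxE.
  have /matrixP/(_ (lift i k) 0) := By; rewrite !mxE.
  rewrite (bigD1_ord i) //= yi mulr0 add0r => S; rewrite -[RHS]S.
  by apply: eq_bigr => a _; rewrite !mxE.
have y'0 : row' i y = 0.
  have u : row' i (col' i B) \in unitmx by rewrite unitmxE unitfE.
  by rewrite -(mulKmx u (row' i y)) By' mulmx0.
suff : y j 0 = 0 by rewrite !mxE mulr1 => /eqP; rewrite subr_eq0 => /eqP.
have [->|ji] := eqVneq j i; first exact: yi.
have [k ->] : exists k, j = lift i k.
  by case: (unliftP i j) => [k ->|ij]; [exists k|rewrite ij eqxx in ji].
by have /matrixP/(_ k 0) := y'0; rewrite !mxE.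
Qed.

(** Once [\det B = 0], the columns of [\adj B] lie in the kernel of [B] and its rows in that of
    [B^T]. Both kernels consist of constant vectors, so all entries equal the one at [(i0, i0)],
    which is the nonzero minor. *)
Lemma adj_const (F : fieldType) (n : nat) (B : 'M[F]_n) (i0 : 'I_n) :
  B *m const_mx 1 = 0 :> 'cV[F]_n -> B^T *m const_mx 1 = 0 :> 'cV[F]_n ->
  \det (row' i0 (col' i0 B)) != 0 ->
  \det B = 0 /\ exists2 c, c != 0 & forall i j, \adj B i j = c.
Proof.
move=> B1 B1t Bi.
have B0 : \det B = 0.
  apply/eqP; apply: contraT => d0.
  have u : B \in unitmx by rewrite unitmxE unitfE.
  have /matrixP/(_ i0 0) := mulKmx u (const_mx 1 : 'cV[F]_n).
  by rewrite B1 mulmx0 !mxE => /esym/eqP; rewrite oner_eq0.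
have cols i j : \adj B i j = \adj B i0 j.
  have := @kernel_const _ _ B i0 (col j (\adj B)) B1 Bi.
  rewrite colE mulmxA mul_mx_adj B0 raddf0 mul0mx -colE => /(_ _ i); rewrite !mxE; exact.
have Bit : \det (row' i0 (col' i0 B^T)) != 0.
  by rewrite -tr_row' -tr_col' det_tr; move: Bi; congr (\det _ != 0);
    apply/matrixP => a b; rewrite !mxE.
have rows i j : \adj B i j = \adj B i i0.
  have := @kernel_const _ _ B^T i0 (col i (\adj B)^T) B1t Bit.
  rewrite colE mulmxA -trmx_mul mul_adj_mx B0 raddf0 trmx0 mul0mx -colE => /(_ _ j).
  rewrite !mxE; exact.
split=> //; exists (\adj B i0 i0); last by move=> i j; rewrite cols rows.
by rewrite mxE /cofactor -signr_odd oddD addbb mul1r.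
Qed.

(** * Closure properties of [C^m] functions on an open set *)

Section CkTheory.
Variables (R : realType) (d : nat).
Implicit Types (f g : 'rV[R]_d -> R) (U : set 'rV[R]_d) (a : 'I_d).

Lemma near_eq_on U f g k : open U -> (forall k, U k -> f k = g k) -> U k ->
  {near k, f =1 g}.
Proof.
by move=> Uo fg Uk; apply: filterS (open_nbhs_nbhs (conj Uo Uk)) => y /fg.
Qed.

(** Differentiation rules identify partial derivatives with their formulas only at points of [U];
    openness makes this agreement local, hence stable under further differentiation. *)
Lemma Ck_ext m U f g : open U -> (forall k, U k -> f k = g k) ->
  Ck m U f -> Ck m U g.
Proof.
move=> Uo; elim: m f g => [|m IH] f g fg [cf df].
  split=> // k Uk; rewrite /prop_for /continuous_at -fg //.
  exact: cvg_trans (near_eq_cvg (near_eq_on Uo fg Uk)) (cf k Uk).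
split=> [k Uk|a].
  rewrite /prop_for /continuous_at -fg //.
  exact: cvg_trans (near_eq_cvg (near_eq_on Uo fg Uk)) (cf k Uk).
have [dfa dCk] := df a; split=> [k Uk|].
  exact: near_eq_derivable (near_eq_on Uo fg Uk) (dfa k Uk).
by apply: IH dCk => k Uk; apply: near_eq_derive (near_eq_on Uo fg Uk).
Qed.

Lemma Ck_continuous m U f : Ck m U f -> forall k, U k -> {for k, continuous f}.
Proof. by case: m => [|m] []. Qed.

Lemma CkW m U f : Ck m.+1 U f -> Ck m U f.
Proof.
elim: m f => [|m IH] f [cf df]; first by split.
by split=> // a; have [dfa dCk] := df a; split=> //; apply: IH.
Qed.

Lemma Ck_cst m U (c : R) : Ck m U (fun=> c).
Proof.
elim: m c => [|m IH] c; split=> //; try by move=> k _; exact: cst_continuous.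
move=> a; split=> [k _|]; first exact: derivable_cst.
suff -> : partial a (fun=> c) = fun=> 0 by [].
by apply/funext => k; rewrite /partial derive_cst.
Qed.

Lemma is_derive_coord (k v : 'rV[R]_d) a : is_derive k v (fun k => k 0 a) (v 0 a).
Proof.
have df : differentiable (fun k : 'rV[R]_d => k 0 a) k by exact: differentiable_coord.
apply: DeriveDef; first exact: diff_derivable.
apply: cvg_lim => //; apply: cvg_near_cst; near=> h.
rewrite /= !mxE addrK scalerA mulVf ?scale1r //.
by near: h; exact: nbhs_dnbhs_neq.
Unshelve. all: by end_near. Qed.

Lemma Ck_coord m U a : Ck m U (fun k => k 0 a).
Proof.
have cc k : {for k, continuous (fun k : 'rV[R]_d => k 0 a)}.
  exact: coord_continuous.
case: m => [|m]; split=> // b; split=> [k _|].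
  by have [] := is_derive_coord k (delta_mx 0 b) a.
suff -> : partial b (fun k => k 0 a) = fun=> (delta_mx 0 b : 'rV[R]_d) 0 a.
  exact: Ck_cst.
by apply/funext => k; have [_] := is_derive_coord k (delta_mx 0 b) a.
Qed.

Lemma CkD m U f g : open U -> Ck m U f -> Ck m U g -> Ck m U (fun k => f k + g k).
Proof.
move=> Uo; elim: m f g => [|m IH] f g [cf df] [cg dg].
  by split=> // k Uk; apply: continuousD; [exact: cf|exact: cg].
split=> [k Uk|a]; first by apply: continuousD; [exact: cf|exact: cg].
have [df' Cf] := df a; have [dg' Cg] := dg a; split=> [k Uk|].
  by apply: derivableD; [exact: df'|exact: dg'].
apply: Ck_ext Uo _ (IH _ _ Cf Cg) => k Uk; apply: esym.
by apply: deriveD; [exact: df'|exact: dg'].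
Qed.

Lemma CkM m U f g : open U -> Ck m U f -> Ck m U g -> Ck m U (fun k => f k * g k).
Proof.
move=> Uo; elim: m f g => [|m IH] f g Ckf Ckg.
  have [[cf _] [cg _]] := (Ckf, Ckg).
  by split=> // k Uk; apply: continuousM; [exact: cf|exact: cg].
have [[cf df] [cg dg]] := (Ckf, Ckg).
split=> [k Uk|a]; first by apply: continuousM; [exact: cf|exact: cg].
have [df' Cf] := df a; have [dg' Cg] := dg a; split=> [k Uk|].
  by apply: derivableM; [exact: df'|exact: dg'].
apply: Ck_ext Uo _ (CkD Uo (IH _ _ (CkW Ckf) Cg) (IH _ _ (CkW Ckg) Cf)) => k Uk.
by apply: esym; apply: deriveM; [exact: df'|exact: dg'].
Qed.

(** Induction on [m]: the partial derivatives are [- f^-1 * f^-1 * partial a f], in which [f^-1] is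
    only needed one order lower. *)
Lemma CkV m U f : open U -> (forall k, U k -> f k != 0) ->
  Ck m U f -> Ck m U (fun k => (f k)^-1).
Proof.
move=> Uo f0; elim: m => [|m IH] Ckf; have [cf df] := Ckf.
  by split=> // k Uk; apply: continuousV; [exact: f0|exact: cf].
split=> [k Uk|a]; first by apply: continuousV; [exact: f0|exact: cf].
have [df' Cf] := df a; split=> [k Uk|].
  by apply: derivableV; [exact: f0|exact: df'].
have CV := IH (CkW Ckf).
apply: Ck_ext Uo _ (CkM Uo (CkM Uo (Ck_cst m U (-1)) (CkM Uo CV CV)) Cf) => k Uk.
apply: esym; rewrite /partial deriveV; [|exact: f0|exact: df'].
by rewrite mulN1r expr2 invfM.
Qed.

End CkTheory.

(** * Polynomial functions of [lam] and [k] *)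

Section Polyfun.
Local Open Scope classical_set_scope.
Local Open Scope ring_scope.
Variables (R : realType) (d : nat).

(** Polynomials in [x] and the coordinates of [k], encoded by their construction so that continuity,
    difference quotients and derivatives follow by induction. *)
Inductive polyfun : (R -> 'rV[R]_d -> R) -> Prop :=
| polyfun_cst c : polyfun (fun _ _ => c)
| polyfun_var : polyfun (fun x _ => x)
| polyfun_coord a : polyfun (fun _ k => k 0 a)
| polyfunD f g : polyfun f -> polyfun g -> polyfun (fun x k => f x k + g x k)
| polyfunM f g : polyfun f -> polyfun g -> polyfun (fun x k => f x k * g x k).

Lemma polyfun_sum (I : Type) (r : seq I) (P : pred I) (F : I -> R -> 'rV[R]_d -> R) :
  (forall i, polyfun (F i)) -> polyfun (fun x k => \sum_(i <- r | P i) F i x k).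
Proof.
move=> pF; elim: r => [|i r IH].
  rewrite (_ : (fun _ _ => _) = fun _ _ => 0); first exact: polyfun_cst.
  by apply/funext => x; apply/funext => k; rewrite big_nil.
rewrite (_ : (fun _ _ => _) =
    fun x k => (if P i then F i x k else 0) + \sum_(j <- r | P j) F j x k).
  by case: (P i); apply: polyfunD => //; exact: polyfun_cst.
by apply/funext => x; apply/funext => k; rewrite big_cons; case: ifP => // _; rewrite add0r.
Qed.

Lemma polyfun_prod (I : Type) (r : seq I) (P : pred I) (F : I -> R -> 'rV[R]_d -> R) :
  (forall i, polyfun (F i)) -> polyfun (fun x k => \prod_(i <- r | P i) F i x k).
Proof.
move=> pF; elim: r => [|i r IH].
  rewrite (_ : (fun _ _ => _) = fun _ _ => 1); first exact: polyfun_cst.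
  by apply/funext => x; apply/funext => k; rewrite big_nil.
rewrite (_ : (fun _ _ => _) =
    fun x k => (if P i then F i x k else 1) * \prod_(j <- r | P j) F j x k).
  by case: (P i); apply: polyfunM => //; exact: polyfun_cst.
by apply/funext => x; apply/funext => k; rewrite big_cons; case: ifP => // _; rewrite mul1r.
Qed.

Lemma polyfun_det (n : nat) (M : R -> 'rV[R]_d -> 'M[R]_n) :
  (forall i j, polyfun (fun x k => M x k i j)) -> polyfun (fun x k => \det (M x k)).
Proof.
move=> pM; apply: polyfun_sum => s; apply: polyfunM; first exact: polyfun_cst.
by apply: polyfun_prod => i; exact: pM.
Qed.

Lemma polyfun_adj (n : nat) (M : R -> 'rV[R]_d -> 'M[R]_n) (i j : 'I_n) :
  (forall i j, polyfun (fun x k => M x k i j)) -> polyfun (fun x k => \adj (M x k) i j).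
Proof.
move=> pM; rewrite (_ : (fun _ _ => _) =
    fun x k => (-1) ^+ (j + i) * \det (row' j (col' i (M x k)))).
  apply: polyfunM; first exact: polyfun_cst.
  apply: polyfun_det => a b; rewrite (_ : (fun _ _ => _) =
    fun x k => M x k (lift j a) (lift i b)); first exact: pM.
  by apply/funext => x; apply/funext => k; rewrite !mxE.
by apply/funext => x; apply/funext => k; rewrite mxE.
Qed.

Lemma polyfun_cvg f (T : Type) (F : set_system T) (xs : T -> R) (ks : T -> 'rV[R]_d)
    (x : R) (k : 'rV[R]_d) :
  Filter F -> polyfun f -> xs @ F --> x -> ks @ F --> k ->
  (fun t => f (xs t) (ks t)) @ F --> f x k.
Proof.
move=> FF pf xsx ksk; elim: pf => [c||a|g h _ IHg _ IHh|g h _ IHg _ IHh] //.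
- exact: cvg_cst.
- exact: (cvg_comp _ _ ksk (@coord_continuous _ _ _ 0 a k)).
- exact: cvgD.
- exact: cvgM.
Qed.

(* Continuity of [Q] is stated along arbitrary filters because it is used both
   on a neighbourhood of the origin and along the curves [h *: e_a]. *)
Lemma polyfun_diff_quotient f : polyfun f -> exists Q : R -> R -> 'rV[R]_d -> R,
  [/\ forall (T : Type) (F : set_system T) (xs ys : T -> R) (ks : T -> 'rV[R]_d) (x y : R)
        (k : 'rV[R]_d),
        Filter F -> xs @ F --> x -> ys @ F --> y -> ks @ F --> k ->
        (fun t => Q (xs t) (ys t) (ks t)) @ F --> Q x y k,
      forall x y k, f x k - f y k = (x - y) * Q x y k
    & polyfun (fun x k => Q x x k)].
Proof.
elim=> [c||a|g h pg [Qg [cg eg dg]] ph [Qh [ch eh dh]]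
  |g h pg [Qg [cg eg dg]] ph [Qh [ch eh dh]]].
- exists (fun _ _ _ => 0); split; last exact: polyfun_cst.
  + by move=> *; exact: cvg_cst.
  + by move=> x y k; rewrite mulr0 subrr.
- exists (fun _ _ _ => 1); split; last exact: polyfun_cst.
  + by move=> *; exact: cvg_cst.
  + by move=> x y k; rewrite mulr1.
- exists (fun _ _ _ => 0); split; last exact: polyfun_cst.
  + by move=> *; exact: cvg_cst.
  + by move=> x y k; rewrite mulr0 subrr.
- exists (fun x y k => Qg x y k + Qh x y k); split; last exact: polyfunD.
  + by move=> *; apply: cvgD; [exact: cg|exact: ch].
  + by move=> x y k; rewrite opprD addrACA eg eh mulrDr.
(* From [g x h x - g y h y = (g x - g y) h x + g y (h x - h y)]. *)
- exists (fun x y k => Qg x y k * h x k + g y k * Qh x y k); split.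
  + move=> *; apply: cvgD; apply: cvgM; [exact: cg| |  |exact: ch].
      exact: polyfun_cvg.
    exact: polyfun_cvg.
  + move=> x y k; rewrite mulrDr mulrA -eg mulrCA -eh; ring.
  + by apply: polyfunD; apply: polyfunM.
Qed.

Lemma polyfun_partial f (a : 'I_d) : polyfun f -> exists2 g, polyfun g &
  forall x k, is_derive k (delta_mx 0 a) (f x) (g x k).
Proof.
elim=> [c||b|f1 f2 p1 [g1 pg1 d1] p2 [g2 pg2 d2]
  |f1 f2 p1 [g1 pg1 d1] p2 [g2 pg2 d2]].
- by exists (fun _ _ => 0) => [|x k]; [exact: polyfun_cst|exact: is_derive_cst].
- by exists (fun _ _ => 0) => [|x k]; [exact: polyfun_cst|exact: is_derive_cst].
- exists (fun _ _ => (delta_mx 0 a : 'rV[R]_d) 0 b) => [|x k]; first exact: polyfun_cst.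
  exact: is_derive_coord.
- by exists (fun x k => g1 x k + g2 x k) => [|x k]; [exact: polyfunD|exact: is_deriveD].
- exists (fun x k => f1 x k * g2 x k + f2 x k * g1 x k) => [|x k].
    by apply: polyfunD; exact: polyfunM.
  exact: is_deriveM.
Qed.

(** Substituting [lam] costs no regularity; this drives the bootstrap for implicit solutions. *)
Lemma polyfun_Ck f (lam : 'rV[R]_d -> R) m U : open U -> polyfun f -> Ck m U lam ->
  Ck m U (fun k => f (lam k) k).
Proof.
move=> Uo pf Cl; elim: pf => [c||a|g h _ IHg _ IHh|g h _ IHg _ IHh] //.
- exact: Ck_cst.
- exact: Ck_coord.
- exact: CkD.
- exact: CkM.
Qed.

End Polyfun.

(** * An implicit function theorem for polynomial functions *)

Section ImplicitFunction.
Local Open Scope classical_set_scope.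
Local Open Scope ring_scope.
Variables (R : realType) (d : nat).

Lemma cvg_shift_scale (k v : 'rV[R]_d) : (fun h : R => h *: v + k) @ 0^' --> k.
Proof.
have : (fun h : R => h *: v + k) @ 0^' --> 0 *: v + k.
  have h0 : (fun h : R => h) @ 0^' --> (0 : R) by exact: nbhs_dnbhs.
  by apply: cvgD; [exact: cvgZr_tmp h0|exact: cvg_cst].
by rewrite scale0r add0r.
Qed.

(* The normalization [Q 0 0 0 = 1] fixes the signs of [p dl k] and [p (- dl) k]
   needed for the intermediate value theorem. *)
Lemma polyfun_implicit_normalized (p : R -> 'rV[R]_d -> R)
    (Q : R -> R -> 'rV[R]_d -> R) : polyfun p ->
  (forall (T : Type) (F : set_system T) (xs ys : T -> R) (ks : T -> 'rV[R]_d) (x y : R)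
      (k : 'rV[R]_d),
     Filter F -> xs @ F --> x -> ys @ F --> y -> ks @ F --> k ->
     (fun t => Q (xs t) (ys t) (ks t)) @ F --> Q x y k) ->
  (forall x y k, p x k - p y k = (x - y) * Q x y k) ->
  polyfun (fun x k => Q x x k) ->
  p 0 0 = 0 -> Q 0 0 0 = 1 ->
  exists lam, [/\ smooth_near 0 lam, lam 0 = 0 &
    \forall k \near (0 : 'rV[R]_d), p (lam k) k = 0].
Proof.
move=> pp Qc pQ pD p0 Q1.
(* The bound [2^-1] is a positive number below [Q 0 0 0 = 1]. Where it holds, [p] is strictly
   increasing in its first argument. *)
have : \forall z \near ((0 : R, 0 : R), 0 : 'rV[R]_d), 2^-1 < Q z.1.1 z.1.2 z.2.
  have cv : (fun z : R * R * 'rV[R]_d => Q z.1.1 z.1.2 z.2) @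
      nbhs ((0 : R, 0 : R), 0 : 'rV[R]_d) --> Q 0 0 0.
    apply: Qc.
    - exact: (cvg_comp _ _ cvg_fst cvg_fst).
    - exact: (cvg_comp _ _ cvg_fst cvg_snd).
    - exact: cvg_snd.
  by apply: (cvgr_gt _ cv); rewrite Q1; lra.
move=> /nbhs_ballP[e /= e0 Qe].
have Q_gt (x y : R) (k : 'rV[R]_d) : `|x| < e -> `|y| < e ->
    ball (0 : 'rV[R]_d) e k -> 2^-1 < Q x y k.
  move=> xe ye ke; apply: (Qe ((x, y), k)); split => //=.
  by split; rewrite /ball /= sub0r normrN.
(* Being smaller than [e], [dl] keeps the closed interval searched for roots inside the region where
   [Q] is bounded below. *)
pose dl := e / 2.
have dl0 : 0 < dl by rewrite divr_gt0.
have dle : dl < e by rewrite /dl; lra.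
have p_cont (x : R) (k : 'rV[R]_d) : p x @ k --> p x k.
  exact: (polyfun_cvg (nbhs_filter k) pp (cvg_cst x) cvg_id).
pose V := [set k : 'rV[R]_d | [/\ ball (0 : 'rV[R]_d) e k, 0 < p dl k & p (- dl) k < 0]].
have nV : nbhs (0 : 'rV[R]_d) V.
  have b0 : ball (0 : 'rV[R]_d) e 0 by exact: ballxx.
  have h1 : \forall k \near (0 : 'rV[R]_d), 0 < p dl k.
    apply: (cvgr_gt _ (p_cont dl 0)).
    have := pQ dl 0 0; rewrite p0 !subr0 => ->; rewrite mulr_gt0 //.
    apply: lt_trans (Q_gt _ _ _ _ _ b0); rewrite ?normr0 // ?gtr0_norm //; lra.
  have h2 : \forall k \near (0 : 'rV[R]_d), p (- dl) k < 0.
    apply: (cvgr_lt _ (p_cont (- dl) 0)).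
    have := pQ (- dl) 0 0; rewrite p0 !subr0 => ->.
    rewrite mulNr oppr_lt0 mulr_gt0 //.
    apply: lt_trans (Q_gt _ _ _ _ _ b0); rewrite ?normrN ?normr0 // ?gtr0_norm //; lra.
  near=> k; split; near: k => //; exact: nbhsx_ballx.
pose U : set 'rV[R]_d := V°.
have Uo : open U by exact: open_interior.
have UV (k : 'rV[R]_d) : U k -> V k by exact: interior_subset.
have U0 : U 0 by exact: nV.
have root (k : 'rV[R]_d) : U k -> exists c, `|c| <= dl /\ p c k = 0.
  move=> /UV[bk pk nk].
  have [|||c cI pc] := @IVT R (p ^~ k) (- dl) dl 0.
  - by lra.
  - apply: continuous_subspaceT => x.
    exact: (polyfun_cvg (nbhs_filter x) pp cvg_id (cvg_cst k)).
  - by rewrite ge_min le_max (ltW pk) (ltW nk) orbT.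
  by exists c; split => //; rewrite ler_norml; move: cI; rewrite in_itv.
pose lam (k : 'rV[R]_d) : R := xget 0 [set c | `|c| <= dl /\ p c k = 0].
have lamP (k : 'rV[R]_d) : U k -> `|lam k| <= dl /\ p (lam k) k = 0.
  move=> /root[c cP].
  exact: (@xgetPex _ 0 [set c | `|c| <= dl /\ p c k = 0]) (ex_intro _ c cP).
have lame (k : 'rV[R]_d) : U k -> `|lam k| < e by move=> /lamP[h _]; exact: le_lt_trans h dle.
have ball_U (k : 'rV[R]_d) : U k -> ball (0 : 'rV[R]_d) e k by move=> /UV[].
have Qpos (k k' : 'rV[R]_d) : U k -> U k' -> 2^-1 < Q (lam k) (lam k') k.
  by move=> Uk Uk'; apply: Q_gt; [exact: lame|exact: lame|exact: ball_U].
have Qn0 (k k' : 'rV[R]_d) : U k -> U k' -> Q (lam k) (lam k') k != 0.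
  by move=> Uk Uk'; have := Qpos _ _ Uk Uk'; apply: contraTneq => ->; rewrite -leNgt; lra.
(* On the right the first argument of [p] stays fixed at [lam k'], so the variation of [lam] is
   controlled by that of [p] in [k] alone. *)
have lam_diff (k k' : 'rV[R]_d) : U k -> U k' ->
    lam k - lam k' = - p (lam k') k / Q (lam k) (lam k') k.
  move=> Uk Uk'; have := pQ (lam k) (lam k') k.
  by rewrite (lamP _ Uk).2 sub0r => ->; rewrite mulfK // Qn0.
have lam0 : lam 0 = 0.
  have := pQ (lam 0) 0 0; rewrite (lamP _ U0).2 p0 subrr subr0 => /esym/eqP.
  rewrite mulf_eq0 => /orP[/eqP //|/eqP Q0].
  have : 2^-1 < Q (lam 0) 0 0 by apply: Q_gt; [exact: lame|rewrite normr0|exact: ballxx].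
  by rewrite Q0; lra.
have nU (k : 'rV[R]_d) : U k -> \forall k' \near k, U k'.
  by move=> Uk; exact: open_nbhs_nbhs.
have lam_cont (k : 'rV[R]_d) : U k -> lam @ k --> lam k.
  move=> Uk; suff : (fun k' => `|lam k' - lam k|) @ k --> (0 : R).
    move/(@norm_cvg0 R R _ (nbhs k) (nbhs_filter k)).
    by move/(@subr_cvg0 R R _ (nbhs k) (nbhs_filter k)).
  (* The factor 2 is the inverse of the lower bound on [Q]. *)
  apply: (@squeeze_cvgr _ (nbhs k) (nbhs_filter k) R (fun=> 0)
    (fun k' => 2 * `|p (lam k) k'|)).
  - near=> k'; rewrite normr_ge0 /= lam_diff //; last by near: k'; exact: nU.
    have Uk' : U k' by near: k'; exact: nU.
    have q := Qpos _ _ Uk' Uk.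
    rewrite normrM normrN mulrC ler_wpM2r // normfV gtr0_norm; last by lra.
    by rewrite -[leRHS]invrK lef_pV2 ?posrE; lra.
  - exact: cvg_cst.
  - have : {for k, continuous (fun k' => 2 * `|p (lam k) k'|)}.
      by apply: continuousM; [exact: cst_continuous|exact: (cvg_norm (p_cont (lam k) k))].
    by rewrite /prop_for /continuous_at (lamP _ Uk).2 normr0 mulr0.
(* [Q x x k] is the derivative of [p] in its first argument, so this is the usual implicit
   derivative. *)
have lam_deriv (a : 'I_d) : exists2 g, polyfun g & forall k, U k ->
    is_derive k (delta_mx 0 a) lam (- g (lam k) k / Q (lam k) (lam k) k).
  have [g pg dg] := polyfun_partial a pp; exists g => // k Uk.
  have [dfa dfe] := dg (lam k) k.
  have sh := @cvg_shift_scale k (delta_mx 0 a : 'rV[R]_d).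
  pose e_a : 'rV[R]_d := delta_mx 0 a.
  have cv : (fun h : R => h^-1 *: ((lam \o shift k) (h *: e_a) - lam k)) @ 0^' -->
      - g (lam k) k / Q (lam k) (lam k) k.
    have : (fun h : R =>
       - (h^-1 *: ((p (lam k) \o shift k) (h *: e_a) - p (lam k) k))
        / Q (lam (h *: e_a + k)) (lam k) (h *: e_a + k)) @ 0^' -->
       - g (lam k) k / Q (lam k) (lam k) k.
      apply: cvgM.
        by apply: cvgN; rewrite -dfe; exact: dfa.
      apply: cvgV; first exact: Qn0.
      apply: Qc => //; last exact: cvg_cst.
      exact: (cvg_comp _ _ sh (lam_cont _ Uk)).
    apply: cvg_trans; apply: near_eq_cvg.
    near=> h.
    have Uh : U (h *: e_a + k) by near: h; exact: (sh _ (nU _ Uk)).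
    by rewrite /= lam_diff // (lamP _ Uk).2 subr0 -scalerN scalerAl.
  by apply: DeriveDef; [apply/cvg_ex; eexists; exact: cv|exact: cvg_lim].
exists lam; split => //; last first.
  by apply: filterS (nU _ U0) => k /lamP[].
exists U; first by [].
(* Bootstrap: if [lam] is [C^m], so are the formulas for its partial derivatives, and [lam] is
   [C^m.+1]. *)
elim=> [|m IH]; first by split.
split=> // a; have [g pg dg] := lam_deriv a; split=> [k Uk|].
  by have [] := dg k Uk.
apply: (@Ck_ext _ _ _ _ (fun k => (-1 * g (lam k) k) * (Q (lam k) (lam k) k)^-1)) => //.
  by move=> k Uk; have [_] := dg k Uk; rewrite mulN1r => <-.
apply: CkM => //; first by apply: CkM => //; [exact: Ck_cst|exact: polyfun_Ck].
apply: CkV => //; first by move=> k Uk; exact: Qn0.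
exact: (polyfun_Ck Uo pD).
Unshelve. all: by end_near. Qed.

(** For [x != 0] the quotient [p x 0 / x] is [Q x 0 0], so [D = Q 0 0 0]. Dividing [p] by [D] keeps
    its zeros and reduces to the normalized case. *)
Lemma polyfun_implicit (p : R -> 'rV[R]_d -> R) (D : R) : polyfun p -> p 0 0 = 0 ->
  (fun x => p x 0 / x) @ 0^' --> D -> D != 0 ->
  exists lam, [/\ smooth_near 0 lam, lam 0 = 0 &
    \forall k \near (0 : 'rV[R]_d), p (lam k) k = 0].
Proof.
move=> pp p0 pD D0; have [Q [Qc pQ Qp]] := polyfun_diff_quotient pp.
have QD : Q 0 0 0 = D.
  have id0 : (fun x : R => x) @ 0^' --> (0 : R).
    exact: nbhs_dnbhs.
  have cQ : (fun x : R => Q x 0 0) @ 0^' --> Q 0 0 0.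
    by apply: (Qc _ _ id (fun=> 0) (fun=> 0)) => //; exact: cvg_cst.
  suff cD : (fun x => Q x 0 0) @ 0^' --> D by exact: (norm_cvg_unique cQ cD).
  apply: cvg_trans pD; apply: near_eq_cvg.
  near=> x; have x0 : x != 0 by near: x; exact: nbhs_dnbhs_neq.
  by have := pQ x 0 0; rewrite p0 !subr0 => ->; rewrite mulrAC mulfV ?mul1r.
have [||||||lam [sl l0 lp]] :=
    @polyfun_implicit_normalized (fun x k => D^-1 * p x k) (fun x y k => D^-1 * Q x y k).
- by apply: polyfunM => //; exact: polyfun_cst.
- by move=> *; apply: cvgM; [exact: cvg_cst|exact: Qc].
- by move=> x y k; rewrite -mulrBr pQ mulrCA.
- by apply: polyfunM => //; exact: polyfun_cst.
- by rewrite p0 mulr0.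
- by rewrite QD mulVf.
exists lam; split => //; apply: filterS lp => k /eqP.
by rewrite mulf_eq0 invr_eq0 (negPf D0) => /eqP.
Unshelve. all: by end_near. Qed.

End ImplicitFunction.

(** * The dispersion relation and its branch through the origin *)

Section Drift.
Local Open Scope classical_set_scope.
Local Open Scope ring_scope.
Variables (R : realType) (d n : nat) (v : 'I_n -> 'rV[R]_d) (mu : 'I_n -> 'I_n -> R).

Let A (lam : R) (k : 'rV[R]_d) : 'M[R]_n :=
  lam%:M + diag_mx (\row_(i < n) dotv (v i) k) + transition_matrix mu.

Lemma transition_matrix_col_sum : const_mx 1 *m transition_matrix mu = 0 :> 'rV[R]_n.
Proof.
apply/matrixP => a j; rewrite !mxE (bigD1 j) //= !mxE eqxx mul1r.
rewrite -big_split /= big1 // => i ij.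
by rewrite !mxE (negPf ij) mul1r subrr.
Qed.

Lemma polyfun_dispersion_matrix i j : polyfun (fun lam k => A lam k i j).
Proof.
rewrite (_ : (fun _ _ => _) = fun lam (k : 'rV[R]_d) => (i == j)%:R * lam +
   (i == j)%:R * (\sum_(a < d) v i 0 a * k 0 a) + transition_matrix mu i j).
  apply: polyfunD; last exact: polyfun_cst.
  apply: polyfunD; apply: polyfunM; do ?[exact: polyfun_cst|exact: polyfun_var].
  apply: polyfun_sum => a; apply: polyfunM; [exact: polyfun_cst|exact: polyfun_coord].
apply/funext => lam; apply/funext => k; rewrite /A !mxE.
by case: eqP => [->|_]; rewrite ?mulr1n ?mul1r // !mulr0n !mul0r.
Qed.

(** Each summand has a factor vanishing at the origin, so first-order limits of [dispersion] there
    involve the adjugate only through its value at the origin. *)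
Lemma dispersion_adj lam k j : dispersion v mu lam k =
  \sum_(i < n) (lam + dotv (v i) k) * \adj (A lam k) i j.
Proof.
have : const_mx 1 *m A lam k *m \adj (A lam k) = const_mx (dispersion v mu lam k) :> 'rV[R]_n.
  by rewrite -mulmxA mul_mx_adj -/(dispersion v mu lam k); apply/matrixP => a b;
    rewrite mul_mx_scalar !mxE mulr1.
move=> /matrixP/(_ 0 j); rewrite !mxE => <-; apply: eq_bigr => i _; congr (_ * _).
rewrite /A !mulmxDr transition_matrix_col_sum addr0 mul_mx_scalar mul_mx_diag.
by rewrite !mxE mul1r mulr1.
Qed.

Lemma dotvZ (u w : 'rV[R]_d) t : dotv u (t *: w) = t * dotv u w.
Proof. by rewrite /dotv mulr_sumr; apply: eq_bigr => a _; rewrite mxE mulrCA. Qed.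

Lemma dotv_delta (u : 'rV[R]_d) a : dotv u (delta_mx 0 a) = u 0 a.
Proof.
rewrite /dotv (bigD1 a) //= mxE !eqxx mulr1 big1 ?addr0 // => b ba.
by rewrite mxE (negPf ba) andbF mulr0.
Qed.

Hypothesis n0 : (0 < n)%N.
Hypothesis hI1 : I1 (transition_matrix mu) != 0.
Hypothesis hsym : (transition_matrix mu)^T = transition_matrix mu.

(** A nonzero sum [I1] has a nonzero minor among its terms, and symmetry turns the zero column sums
    into zero row sums. *)
Lemma transition_adj_const : \det (transition_matrix mu) = 0 /\
  exists2 c, c != 0 & forall i j, \adj (transition_matrix mu) i j = c.
Proof.
have [i hi] : exists i, \det (minor_matrix i (transition_matrix mu)) != 0.
  apply/existsP; apply: contraNT hI1; rewrite negb_exists => /forallP h.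
  by apply/eqP; apply: big1 => i _; apply/eqP; have := h i; rewrite negbK.
have row0 : transition_matrix mu *m const_mx 1 = 0 :> 'cV[R]_n.
  have := congr1 trmx transition_matrix_col_sum.
  by rewrite trmx_mul hsym trmx_const trmx0.
by apply: adj_const hi; rewrite ?hsym.
Qed.

Lemma A00 : A 0 0 = transition_matrix mu.
Proof.
rewrite /A raddf0 add0r (_ : (\row_i dotv (v i) 0) = 0) ?raddf0 ?add0r //.
by apply/matrixP => a b; rewrite !mxE /dotv big1 // => c _; rewrite mxE mulr0.
Qed.

Lemma branch_exists : exists lam, is_branch v mu lam.
Proof.
have [det0 [c c0 adjc]] := transition_adj_const.
have pdisp : polyfun (dispersion v mu).
  by apply: polyfun_det; exact: polyfun_dispersion_matrix.
have [|||lam [sl l0 lp]] := @polyfun_implicit R d (dispersion v mu) (n%:R * c) pdisp.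
- by rewrite /dispersion -/(A 0 0) A00.
- pose j := Ordinal n0.
  have padj i : polyfun (fun x k => \adj (A x k) i j).
    by apply: polyfun_adj; exact: polyfun_dispersion_matrix.
  have id0 : (fun x : R => x) @ 0^' --> (0 : R) by exact: nbhs_dnbhs.
  (* At [k = 0] every factor in [dispersion_adj] is [x], so this sum is [dispersion v mu x 0 / x]
     for [x != 0]. *)
  have : (fun x : R => \sum_(i < n) \adj (A x 0) i j) @ 0^' --> n%:R * c.
    rewrite (_ : n%:R * c = \sum_(i < n) \adj (A 0 0) i j); last first.
      under eq_bigr do rewrite A00 adjc.
      by rewrite sumr_const card_ord mulr_natl.
    apply: (cvg_big (@add_continuous R)) => i _.
    exact: (polyfun_cvg _ (padj i) id0 (cvg_cst (0 : 'rV[R]_d))).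
  apply: cvg_trans; apply: near_eq_cvg; near=> x.
  have x0 : x != 0 by near: x; exact: nbhs_dnbhs_neq.
  rewrite (dispersion_adj _ _ j) mulr_suml; apply: eq_bigr => i _.
  rewrite (_ : dotv (v i) 0 = 0) ?addr0 1?mulrAC ?mulfV ?mul1r //.
  by rewrite /dotv big1 // => a _; rewrite mxE mulr0.
- by rewrite mulf_neq0 // pnatr_eq0 -lt0n.
by exists lam.
Unshelve. all: by end_near. Qed.

Lemma branch_partial lam a : is_branch v mu lam ->
  n%:R * partial a lam 0 = - \sum_(i < n) v i 0 a.
Proof.
move=> [[U [Uo U0] lamC] lam0 lamp].
have [_ [c c0 adjc]] := transition_adj_const.
have [lam_cont lam_d] := lamC 1%N.
have [dlam _] := lam_d a.
have {}dlam : derivable lam 0 (delta_mx 0 a) by exact: dlam.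
pose j := Ordinal n0; pose e : 'rV[R]_d := delta_mx 0 a.
have sh : (fun h : R => h *: e) @ 0^' --> (0 : 'rV[R]_d).
  have := @cvg_shift_scale R d 0 e; apply: cvg_trans; apply: near_eq_cvg.
  by apply: nearW => h; rewrite addr0.
have lamh : (fun h : R => lam (h *: e)) @ 0^' --> (0 : R).
  by have := cvg_comp _ _ sh (lam_cont 0 U0); rewrite lam0.
have dq : (fun h : R => h^-1 * lam (h *: e)) @ 0^' --> partial a lam 0.
  have : (fun h : R => h^-1 *: ((lam \o shift 0) (h *: e) - lam 0)) @ 0^' -->
    partial a lam 0 by exact: dlam.
  apply: cvg_trans; apply: near_eq_cvg; apply: nearW => h.
  by rewrite /= addr0 lam0 subr0.
have padj i : polyfun (fun x k => \adj (A x k) i j).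
  by apply: polyfun_adj; exact: polyfun_dispersion_matrix.
have lim0 : (fun h : R => \sum_(i < n) (h^-1 * lam (h *: e) + v i 0 a) *
    \adj (A (lam (h *: e)) (h *: e)) i j) @ 0^' -->
    \sum_(i < n) (partial a lam 0 + v i 0 a) * c.
  apply: (cvg_big (@add_continuous R)) => i _; apply: cvgM.
    by apply: cvgD; [exact: dq|exact: cvg_cst].
  rewrite -(adjc i j) -A00.
  exact: (polyfun_cvg _ (padj i) lamh sh).
(* For small [h != 0] the same function is [h^-1] times the dispersion on the branch, hence zero;
   comparing the two limits gives the equation. *)
have lim0' : (fun h : R => \sum_(i < n) (h^-1 * lam (h *: e) + v i 0 a) *
    \adj (A (lam (h *: e)) (h *: e)) i j) @ 0^' --> (0 : R).
  apply: cvg_near_cst; near=> h.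
  have h0 : h != 0 by near: h; exact: nbhs_dnbhs_neq.
  have : dispersion v mu (lam (h *: e)) (h *: e) = 0.
    by near: h; exact: (sh _ lamp).
  rewrite (dispersion_adj _ _ j) => /(congr1 (fun t => h^-1 * t)).
  rewrite mulr0 mulr_sumr => S; rewrite -[RHS]S; apply: eq_bigr => i _.
  by rewrite mulrA mulrDr dotvZ dotv_delta mulKf.
have /eqP : \sum_(i < n) (partial a lam 0 + v i 0 a) * c = 0.
  exact: (norm_cvg_unique lim0 lim0').
rewrite -mulr_suml mulf_eq0 (negPf c0) orbF big_split /= sumr_const card_ord.
by rewrite addr_eq0 mulr_natl => /eqP.
Unshelve. all: by end_near. Qed.

End Drift.

Theorem theorem3p7 (R : realType) (d n : nat) (hd : (1 <= d)%N) (hn : (1 <= n)%N)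
    (v : 'I_n -> 'rV[R]_d) (mu : 'I_n -> 'I_n -> R)
    (hmu : forall i j : 'I_n, i != j -> 0 <= mu i j)
    (hI1 : I1 (transition_matrix mu) != 0)
    (hsym : (transition_matrix mu)^T = transition_matrix mu) :
  drift_velocity v mu = n%:R^-1 *: \sum_(i < n) v i.
Proof.
(* Since a branch exists, [xget] returns a branch and not its default, the zero function. *)
have bP : is_branch v mu (branch v mu).
  by have [lam lamP] := branch_exists v hn hI1 hsym; exact: (xgetPex _ (ex_intro _ lam lamP)).
have n0 : n%:R != 0 :> R by rewrite pnatr_eq0 -lt0n.
apply/matrixP => i a; rewrite ord1 !mxE; apply: (mulfI n0).
by rewrite mulrN (branch_partial hn hI1 hsym a bP) opprK mulVKf // summxE.
Qed.
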